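(* Let $l \in \mathbb{N}$ with $l \geq 16$, let $G = K_{2,l}$, and let $q = \lfloor l/4 \rfloor$. Then $$\tau(G) > \left\lfloor \left(\frac{q}{\ln(16/7)}\right)^{1/2} + 1 \right\rfloor.$$ Consequently, there is a constant $C > 0$ such that for each integer $l \geq 16$, $\tau(K_{2,l}) - \chi_{\ell}(K_{2,l}) = \tau(K_{2,l}) - 3 \geq C\sqrt{l}$.
   Context: All graphs are nonempty, finite and simple; $\mathbb{N} = \{1,2,3,\ldots\}$, and $[m] = \{1,\ldots,m\}$ for $m\in\mathbb{N}$. $K_{n,l}$ is the complete bipartite graph with partite sets of sizes $n$ and $l$. $P(G,m)$ is the number of proper colorings of $G$ with colors from $[m]$, and $\chi(G)$ is the chromatic number of $G$. A list assignment $L$ for $G$ assigns to each vertex $v$ a set $L(v)$ of colors; it is an $m$-assignment if $|L(v)| = m$ for every $v \in V(G)$. A proper $L$-coloring of $G$ is a proper coloring $f$ with $f(v) \in L(v)$ for every $v \in V(G)$, and $P(G,L)$ is the number of proper $L$-colorings of $G$. The list chromatic number $\chi_\ell(G)$ is the smallest $k$ such that $G$ has a proper $L$-coloring for every $k$-assignment $L$ for $G$. The list color function $P_\ell(G,m)$ is the minimum of $P(G,L)$ over all $m$-assignments $L$ for $G$. The list color function threshold $\tau(G)$ is the smallest integer $k \geq \chi(G)$ such that $P_\ell(G,m) = P(G,m)$ for all integers $m \geq k$ (such a $k$ is known to exist for every graph $G$). *)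

(* Defs.v *)
From mathcomp Require Import all_boot all_order all_algebra finmap.
From mathcomp Require Import boolp classical_sets.

Set Implicit Arguments.
Unset Strict Implicit.
Unset Printing Implicit Defensive.

Import Order.TTheory GRing.Theory Num.Theory.

(* The empty graph is not excluded here; as every definition below is stated
   graph by graph, this has no effect on the values at nonempty graphs. *)
Record sgraph := SGraph {
  vertex :> finType;
  adj : rel vertex;
  adj_sym : symmetric adj;
  adj_irr : irreflexive adj }.

Definition bip_adj (n l : nat) : rel ('I_n + 'I_l)%type :=
  fun u v => match u, v with
             | inl _, inr _ | inr _, inl _ => true
             | _, _ => false
             end.

Lemma bip_adj_sym n l : symmetric (@bip_adj n l).
Proof. by case=> ? [] ?. Qed.

Lemma bip_adj_irr n l : irreflexive (@bip_adj n l).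
Proof. by case. Qed.

Definition complete_bipartite (n l : nat) : sgraph :=
  SGraph (@bip_adj_sym n l) (@bip_adj_irr n l).

Notation "''K_{' n , l }" := (complete_bipartite n l)
  (at level 0, n at level 50, l at level 50, format "''K_{' n ,  l }").

(* The smallest element of a set of naturals, and 0 if the set is empty. All the
   sets used below are nonempty; for [threshold] this is a nontrivial theorem,
   and the default 0 makes [b < threshold G], for [0 <= b], imply it for [G]. *)
Definition least (P : set nat) : nat := xget 0 (P `&` lbound P)%classic.

Lemma leastP (P : set nat) : (P !=set0)%classic ->
  P (least P) /\ forall k, P k -> least P <= k.
Proof.
move=> [n Pn]; have exP : exists k, `[< P k >] by exists n; apply/asboolP.
have [m /asboolP Pm minm] := ex_minnP exP.
suff [? lbP] : (P `&` lbound P)%classic (least P).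
  by split=> // k Pk; have := lbP k Pk; rewrite leEnat.
by apply: (xgetI _ (x := m)); split=> // k Pk; rewrite leEnat; apply/minm/asboolP.
Qed.

Section Coloring.
Variable G : sgraph.

Definition proper_coloring (C : eqType) (f : G -> C) : bool :=
  [forall u, forall v, adj u v ==> (f u != f v)].

(* The colors [m] = {1, ..., m} are represented by 'I_m = {0, ..., m - 1}. *)
Definition chromatic_poly (m : nat) : nat :=
  #|[set f : {ffun G -> 'I_m} | proper_coloring f]%SET|.

Definition chromatic_number : nat :=
  least [set k | exists f : {ffun G -> 'I_k}, proper_coloring f]%classic.

(* Colors are natural numbers: this is no restriction, since the finitely many
   finite lists of an assignment involve only finitely many colors. *)
Definition list_assignment := G -> {fset nat}.

Definition is_massignment (m : nat) (L : list_assignment) : Prop :=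
  forall v, #|` L v| = m.

(* An L-coloring takes its values in the finite union of all the lists. *)
Definition palette (L : list_assignment) : {fset nat} :=
  (\bigcup_(v <- enum G) L v)%fset.

Definition list_colorings (L : list_assignment) : {set {ffun G -> palette L}} :=
  [set f : {ffun G -> palette L} |
    [forall v, val (f v) \in L v] && proper_coloring f]%SET.

Definition num_list_colorings (L : list_assignment) : nat :=
  #|list_colorings L|.

Definition list_chromatic_number : nat :=
  least [set k | forall L, is_massignment k L ->
                   exists f, f \in list_colorings L]%classic.

Definition list_color_function (m : nat) : nat :=
  least [set num_list_colorings L | L in is_massignment m]%classic.

Definition threshold : nat :=
  least [set k | chromatic_number <= k /\ forall m, k <= m ->
                   list_color_function m = chromatic_poly m]%classic.

End Coloring.

(* Main.v *)
Require Import Defs.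
From mathcomp Require Import all_boot all_order all_algebra finmap.
From mathcomp Require Import boolp classical_sets reals sequences exp.
From mathcomp Require Import zify ring lra.

Set Implicit Arguments.
Unset Strict Implicit.
Unset Printing Implicit Defensive.

Import Order.TTheory GRing.Theory Num.Theory.

(** Once the two vertices on the small side of K_{2,l} are colored a and b, each
    of the l other vertices w chooses its color freely in L(w) minus {a, b}.
    Hence P(K_{2,l}, L) is the sum over a in L(u), b in L(v) of the product over
    w of |L(w) \ {a, b}| ([num_list_colorings_K2]); for equal lists this is
    P(K_{2,l}, m) = m (m-1)^l + m (m-1) (m-2)^l.

    Lower bound on the threshold.  Put m = k + 2, n = k + 1 and l = 4 q + r with
    r < 4. Take k colors common to all lists, let L(u) contain besides these two
    private colors 0, 1, and L(v) two private colors 2, 3. Each of the four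
    pairs (one color of u, one color of v) completes the list of q of the
    vertices w, and the r remaining vertices get the list L(u). Divide the
    number of colorings by n^l. The k pairs (c, c) contribute k instead of the
    k + 2 of the constant assignment, so that 2 units are available; the pairs
    (c, d) of distinct common colors are fewer than the pairs of distinct colors
    for equal lists; the 4 pairs of private colors contribute at most
    4 (1 - 1/n^2)^q <= 4 exp(- q/n^2); and the 4 k pairs with exactly one private
    color contribute at most 4 k (1 - 1/n)^(2 q) <= 4 k exp(- 2 q/n).  If
    n <= sqrt(q / ln(16/7)), these are at most 7/4 and 4 k (7/16)^(2 n) < 1/4:
    the m-assignment has fewer colorings than the constant one
    ([num_bad_colorings_lt], [bad_condition]), and the threshold exceeds m
    ([threshold_K2_gt]).

    This argument needs the threshold to be a genuine minimum, that is,
    P_l(K_{2,l}, m) = P(K_{2,l}, m) for all large m; it is proved for m >= l + 1,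
    m >= 3 ([list_color_function_K2]). Let j be the number of colors of L(u) outside
    L(v). Passing from equal lists to L turns j pairs (a, a) into pairs of
    distinct colors, at a cost of at most j (n^l - (n-1)^l). On the other hand
    every w misses at least j colors of L(u) and L(v), counted in both lists,
    because |L(w)| = m; each miss gives w one more choice for at least n pairs,
    for a total gain of at least n l j (n-1)^(l-1). Bernoulli's inequality shows
    that the gain outweighs the cost as soon as n >= l ([expS_gap]).

    With k = 0 the same assignment has no coloring at all, so that K_{2,l} is
    not 2-choosable for l >= 4; its list chromatic number is 3. The bound
    C sqrt(l) then follows from ln(16/7) < 1 and q >= 4: if
    D = ln(16/7)^(-1/2) - 1 > 0 then
    sqrt(q / ln(16/7)) + 1 - 3 >= D sqrt q >= (D/3) sqrt l. *)

(** * Counting colorings of K_{2,l} *)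

Section Count.
Variables (l : nat) (T : finType) (S : 'K_{2, l} -> {set T}).
Local Notation hub0 := (inl ord0 : 'K_{2, l}).
Local Notation hub1 := (inl ord_max : 'K_{2, l}).

Lemma proper_K2P (C : eqType) (f : 'K_{2, l} -> C) :
  reflect (forall i : 'I_l, f (inr i) != f hub0 /\ f (inr i) != f hub1)
          (proper_coloring f).
Proof.
apply: (iffP forallP) => [fP i | fP u].
  have /forallP/(_ (inr i))/implyP := fP hub0.
  have /forallP/(_ (inr i))/implyP := fP hub1.
  by rewrite ![_ == f (inr i)]eq_sym => -> // ->.
have hubE (a : 'I_2) : (a = ord0) \/ (a = ord_max).
  by case: (unliftP ord0 a) => [j ->|->]; [right; apply/val_inj; rewrite /= ord1 | left].
apply/forallP => v; apply/implyP; case: u v => [a|i] [b|j] //= _.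
  by rewrite eq_sym; case: (hubE a) => ->; case: (fP j).
by case: (hubE b) => ->; case: (fP i).
Qed.

(** The colors [S] are sets in an arbitrary finite type, so that the formula
    serves both for colorings by ['I_m] and for list colorings in a palette:
    classify the colorings by the colors of the two hubs; the other vertices are
    adjacent to the hubs only and choose independently. *)
Lemma card_colorings_K2 :
  #|[set f : {ffun 'K_{2, l} -> T} |
      [forall v, f v \in S v] && proper_coloring f]| =
  \sum_(a in S hub0) \sum_(b in S hub1) \prod_(i < l) #|S (inr i) :\ a :\ b|.
Proof.
rewrite pair_big_dep /= -sum1_card.
rewrite (partition_big (fun f : {ffun 'K_{2, l} -> T} => (f hub0, f hub1))
  (fun p => (p.1 \in S hub0) && (p.2 \in S hub1))) /=; last first.
  by move=> f; rewrite inE => /andP[/forallP fS _]; rewrite !fS.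
apply: eq_bigr => -[a b] /= /andP[aS bS].
pose F (v : 'K_{2, l}) : {set T} := match v with
  | inl j => if j == ord0 then [set a] else [set b]
  | inr i => S (inr i) :\ a :\ b end.
transitivity #|(family F : simpl_pred {ffun 'K_{2, l} -> T})|.
  rewrite -sum1_card; apply: eq_bigl => f; rewrite inE.
  apply/andP/familyP => [[/andP[/forallP fS /proper_K2P fP] /eqP[fa fb]] | fF].
    case=> [j|i] /=; last by case: (fP i); rewrite !inE fS fa fb => -> ->.
    by case: (unliftP ord0 j) => [j' ->|->] /=; rewrite inE -?fb -?fa //;
      apply/eqP; congr (f (inl _)); apply/val_inj; rewrite /= ord1.
  have fa : f hub0 = a by have := fF hub0; rewrite inE => /eqP.
  have fb : f hub1 = b by have := fF hub1; rewrite inE => /eqP.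
  split; last by rewrite fa fb.
  apply/andP; split; last first.
    by apply/proper_K2P => i; rewrite fa fb; have := fF (inr i); rewrite !inE => /and3P[-> ->].
  apply/forallP => -[j|i]; last by have := fF (inr i); rewrite !inE => /and3P[].
  case: (unliftP ord0 j) => [j' ->|->]; last by rewrite fa.
  suff -> : lift ord0 j' = ord_max by rewrite fb.
  by apply/val_inj; rewrite /= ord1.
rewrite card_family foldrE big_map big_enum /= big_sumType /=.
rewrite big_ord_recl big_ord1 /= !cards1 !mul1n.
by apply: eq_bigr.
Qed.

End Count.

Lemma card_colorings_K2_const l (T : finType) (S : 'K_{2, l} -> {set T})
    (A : {set T}) m : (forall v, S v = A) -> #|A| = m ->
  #|[set f : {ffun 'K_{2, l} -> T} |
      [forall v, f v \in S v] && proper_coloring f]| =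
  m * m.-1 ^ l + m * m.-1 * m.-2 ^ l.
Proof.
move=> SA Am; rewrite card_colorings_K2 !SA.
transitivity (\sum_(a in A) (m.-1 ^ l + m.-1 * m.-2 ^ l)); last first.
  by rewrite sum_nat_const Am mulnDr mulnA.
apply: eq_bigr => a aA; have A1 := cardsD1 a A; rewrite aA Am in A1.
rewrite (bigD1 a) //=; congr (_ + _).
  under eq_bigr do rewrite SA.
  rewrite prod_nat_const card_ord; congr (_ ^ _).
  by have := cardsD1 a (A :\ a); rewrite !inE eqxx add0n => <-; rewrite A1.
transitivity (\sum_(b in A :\ a) m.-2 ^ l); last first.
  by rewrite sum_nat_const A1.
apply: eq_big => [b|b /andP[bA ba]]; first by rewrite !inE andbC.
under eq_bigr do rewrite SA.
rewrite prod_nat_const card_ord; congr (_ ^ _).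
by have := cardsD1 b (A :\ a); rewrite !inE ba bA /= A1 => ->.
Qed.

Lemma chromatic_poly_K2 l m :
  chromatic_poly 'K_{2, l} m = m * m.-1 ^ l + m * m.-1 * m.-2 ^ l.
Proof.
rewrite -(@card_colorings_K2_const l _ (fun=> [set: 'I_m]%SET) [set: 'I_m]%SET m) //; last first.
  by rewrite cardsT card_ord.
congr #|pred_of_set _|; apply/setP => f; rewrite !inE.
by rewrite (_ : [forall _, _] = true) //; apply/forallP => v; rewrite inE.
Qed.

Section Lists.
Variables (G : sgraph) (L : list_assignment G).

Definition palette_list (v : G) : {set palette L} := [set x | val x \in L v].

Lemma num_list_colorings_palette :
  num_list_colorings L =
  #|[set f : {ffun G -> palette L} |
      [forall v, f v \in palette_list v] && proper_coloring f]|.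
Proof.
congr #|pred_of_set _|; apply/setP => f; rewrite !inE; congr (_ && _).
by apply: eq_forallb => v; rewrite inE.
Qed.

Lemma mem_palette v x : x \in L v -> x \in palette L.
Proof. by move=> xL; apply/bigfcupP; exists v; rewrite // mem_enum. Qed.

(** Sums over the palette and sums over a list exchange here: the palette is
    needed only to have a finite type of colors. *)
Lemma big_palette (A : {fset nat}) (F : nat -> nat) v :
    {subset A <= L v} ->
  \sum_(x : palette L | val x \in A) F (val x) = \sum_(x <- A) F x.
Proof.
move=> AL; rewrite -[LHS](big_seq_fsetE _ (palette L) (mem A) F) -big_filter.
apply/perm_big/uniq_perm; rewrite ?filter_uniq ?fset_uniq // => x.
rewrite mem_filter; apply: andb_idr => /AL; exact: mem_palette.
Qed.

Lemma card_palette_list v : #|palette_list v| = #|` L v|.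
Proof.
rewrite -sum1_card cardfE -sum1_card -(big_seq_fsetE _ (L v) xpredT (fun=> 1)) /=.
by rewrite -(@big_palette _ (fun=> 1) v) //; apply: eq_bigl => x; rewrite inE.
Qed.
End Lists.

Lemma num_list_colorings_K2 l (L : list_assignment 'K_{2, l}) :
  num_list_colorings L =
  \sum_(a <- L (inl ord0)) \sum_(b <- L (inl ord_max))
     \prod_(i < l) #|` (L (inr i) `\ a `\ b)%fset|.
Proof.
rewrite num_list_colorings_palette card_colorings_K2.
rewrite -(@big_palette _ L _ _ (inl ord0)) //; apply: eq_big => [x|a _]; first by rewrite inE.
rewrite -(@big_palette _ L _ _ (inl ord_max)) //; apply: eq_big => [x|b _]; first by rewrite inE.
apply: eq_bigr => i _.
rewrite -sum1_card cardfE -sum1_card.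
rewrite -(big_seq_fsetE _ (L (inr i) `\ val a `\ val b)%fset xpredT (fun=> 1)) /=.
rewrite -(@big_palette _ L _ (fun=> 1) (inr i)).
  by apply: eq_bigl => x; rewrite !inE.
by move=> x; rewrite !inE => /and3P[].
Qed.

(** * Constant lists are optimal for many colors *)

(** Bernoulli's inequality (p / (p+1))^j >= 1 - j / (p+1), without
    denominators. *)
Lemma expS_bernoulli p j : j <= p -> p.+1 ^ j * (p.+1 - j) <= p.+1 * p ^ j.
Proof.
elim: j => [|j IH] jp; first by rewrite subn0 mulnC.
have {}IH := IH (ltnW jp).
have E : p.+1 * (p.+1 - j.+1) <= (p.+1 - j) * p.
  have [t ->] : exists t, p = j + t by exists (p - j); rewrite subnKC // ltnW.
  rewrite -!addnS addKn -addSnnS addKn; nia.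
have := leq_mul (leqnn (p.+1 ^ j)) E; have := leq_mul IH (leqnn p).
by rewrite !expnS; lia.
Qed.

(** The loss when a pair of equal hub colors is replaced by a pair of distinct
    ones, n^(l+1) - p^(l+1) with n = p + 1, against the gain n (l+1) p^l from the
    colors that the other lists miss. By convexity the loss is at most
    (l+1) n^l, and Bernoulli gives n^l <= n p^l. *)
Lemma expS_gap p l : l <= p ->
  p.+1 ^ l.+1 <= p ^ l.+1 + p.+1 * l.+1 * p ^ l.
Proof.
move=> lp.
have H : forall k, p.+1 ^ k.+1 <= p ^ k.+1 + k.+1 * p.+1 ^ k.
  elim=> [|k IH]; first by rewrite !expn1 expn0; lia.
  rewrite expnS mulSn; apply: (leq_trans (leq_mul (leqnn p.+1) IH)).
  have : p ^ k.+1 <= p.+1 ^ k.+1 by rewrite leq_exp2r.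
  by rewrite !(expnS _ k.+1) (expnS p.+1 k); nia.
apply: (leq_trans (H l)); rewrite leq_add2l.
have := expS_bernoulli lp; have : 0 < p.+1 - l by lia.
nia.
Qed.

(** First-order expansion of the product; the extra factor [p] on both sides
    avoids the exponent l - 1. *)
Lemma prod_add_ge l p (e : 'I_l -> nat) :
  p ^ l * (p + \sum_i e i) <= p * \prod_i (p + e i).
Proof.
elim: l e => [|l IH] e; first by rewrite !big_ord0 addn0 mulnC.
rewrite !big_ord_recr /= expnS.
have := IH (fun i => e (widen_ord (leqnSn l) i)).
set s := \sum_(_ < _) _; set t := \prod_(_ < _) _.
move=> /(leq_mul)/(_ (leqnn (p + e ord_max))) => H.
rewrite [leqRHS]mulnA; apply: leq_trans H; nia.
Qed.

Section LowerBound.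
Variables (T : finType) (l p : nat) (A B : {set T}) (W : 'I_l.+1 -> {set T}).
Hypotheses (p_gt0 : 0 < p) (lp : l <= p).
Hypotheses (cA : #|A| = p.+2) (cB : #|B| = p.+2) (cW : forall i, #|W i| = p.+2).

Let missing a := \sum_(i < l.+1) (a \notin W i).

Lemma sum_missing (X : {set T}) :
  \sum_(a in X) missing a = \sum_(i < l.+1) #|X :\: W i|.
Proof.
rewrite exchange_big /=; apply: eq_bigr => i _.
rewrite -sum1_card big_mkcond [RHS]big_mkcond /=; apply: eq_bigr => a _.
by rewrite inE andbC; do 2 case: (_ \in _).
Qed.

(** Each [W i] has only p + 2 elements for the two sets [A] and [B]:
    |A & W| + |B & W| = |(A | B) & W| + |A & B & W| <= p + 2 + |A & B|. *)
Lemma sum_missing_ge :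
  l.+1 * (p.+2 - #|A :&: B|) <=
  \sum_(a in A) missing a + \sum_(b in B) missing b.
Proof.
rewrite !sum_missing -big_split /= -[X in X * _]card_ord -sum_nat_const.
apply: leq_sum => i _.
have h1 := cardsID (W i) A; have h2 := cardsID (W i) B; rewrite cA in h1; rewrite cB in h2.
have h3 := cardsUI (A :&: W i) (B :&: W i).
have h4 : #|(A :&: W i) :|: (B :&: W i)| <= p.+2.
  by rewrite -(cW i) -finset.setIUl subset_leq_card // finset.subsetIr.
have h5 : #|(A :&: W i) :&: (B :&: W i)| <= #|A :&: B|.
  by rewrite subset_leq_card // finset.setISS // finset.subsetIl.
lia.
Qed.

(** A color of one hub forms a pair of distinct colors with at least p + 1 of
    the p + 2 colors of the other hub. *)
Lemma sum_pairs_missing_ge :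
  p.+1 * (\sum_(a in A) missing a + \sum_(b in B) missing b) <=
  \sum_(a in A) \sum_(b in B) (a != b) * (missing a + missing b).
Proof.
have H (X : {set T}) a : #|X| = p.+2 -> p.+1 <= \sum_(b in X) (a != b).
  move=> cX; rewrite -[p.+1]addn0.
  have -> : \sum_(b in X) (a != b) = #|X :\ a|.
    rewrite -sum1_card big_mkcond [RHS]big_mkcond /=; apply: eq_bigr => b _.
    by rewrite !inE eq_sym; case: (b == a); case: (_ \in _).
  by have := cardsD1 a X; lia.
have -> : \sum_(a in A) \sum_(b in B) (a != b) * (missing a + missing b) =
    \sum_(a in A) (\sum_(b in B) (a != b)) * missing a +
    \sum_(b in B) (\sum_(a in A) (b != a)) * missing b.
  under [X in _ + X]eq_bigr do rewrite big_distrl.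
  rewrite [X in _ + X]exchange_big -big_split; apply: eq_bigr => a _.
  rewrite big_distrl -big_split; apply: eq_bigr => b _ /=.
  by rewrite mulnDr [b == a]eq_sym.
by rewrite mulnDr !big_distrr leq_add // leq_sum // => a _; rewrite leq_mul ?H.
Qed.

(** Linear lower bound on the number of ways to extend a coloring of the hubs:
    every list that misses [a] or [b] leaves one more choice. *)
Lemma card_extensions_ge a b :
  (a != b) * p ^ l.+1 + (a == b) * p.+1 ^ l.+1 +
     (a != b) * (missing a + missing b) * p ^ l
  <= \prod_(i < l.+1) #|W i :\ a :\ b|.
Proof.
have [<-|ab] := eqVneq a b; rewrite !(mul0n, mul1n, add0n, addn0).
  rewrite -[X in _ ^ X]card_ord -prod_nat_const; apply: leq_prod => i _.
  by have := cardsD1 a (W i); have := cardsD1 a (W i :\ a); rewrite cW !inE eqxx /=; lia.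
rewrite (eq_bigr (fun i => p + ((a \notin W i) + (b \notin W i)))); last first.
  move=> i _; have := cardsD1 a (W i); have := cardsD1 b (W i :\ a).
  by rewrite cW !inE eq_sym ab /=; lia.
rewrite -(leq_pmul2l p_gt0); apply: leq_trans (prod_add_ge _ _).
by rewrite -big_split /= !expnS; nia.
Qed.

Lemma sum_extensions_ge :
  p.+2 * p.+1 ^ l.+1 + p.+2 * p.+1 * p ^ l.+1 <=
  \sum_(a in A) \sum_(b in B) \prod_(i < l.+1) #|W i :\ a :\ b|.
Proof.
apply: (@leq_trans (\sum_(a in A) \sum_(b in B) ((a != b) * p ^ l.+1 + (a == b) * p.+1 ^ l.+1 +
     (a != b) * (missing a + missing b) * p ^ l))); last first.
  by apply: leq_sum => a _; apply: leq_sum => b _; apply: card_extensions_ge.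
have eqE : \sum_(a in A) \sum_(b in B) (a == b) = #|A :&: B|.
  rewrite -sum1_card [RHS](eq_bigl (fun a => (a \in A) && (a \in B))); last by move=> a; rewrite inE.
  rewrite [RHS]big_mkcondr; apply: eq_bigr => a _.
  case: ifP => aB; last by rewrite big1 // => b bB; case: eqP => // ab; rewrite ab bB in aB.
  by rewrite (bigD1 a) //= eqxx big1 ?addn0 // => b /andP[_ /negPf]; rewrite eq_sym => ->.
have neE : \sum_(a in A) \sum_(b in B) (a != b) = p.+2 * p.+2 - #|A :&: B|.
  rewrite -eqE; apply: (@addnI (\sum_(a in A) \sum_(b in B) (a == b))).
  rewrite subnKC; last first.
    rewrite -[X in X * _]cA -sum_nat_const leq_sum // => a _.
    by rewrite -cB -sum1_card leq_sum // => b _; case: eqP.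
  rewrite -big_split /= -[X in X * _]cA -sum_nat_const; apply: eq_bigr => a _.
  rewrite -big_split -cB -sum1_card; apply: eq_bigr => b _ /=; by case: eqP.
under [leqRHS]eq_bigr do rewrite !big_split -!big_distrl /=.
rewrite !big_split -!big_distrl /= eqE neE.
have := leq_trans (leq_mul (leqnn p.+1) sum_missing_ge) sum_pairs_missing_ge.
set S := \sum_(a in A) _; set k := #|_|.
have kp : k <= p.+2 by rewrite -cA subset_leq_card // finset.subsetIl.
have := expS_gap lp.
set j := p.+2 - k; set X := p.+1 ^ _; set P := p ^ l.+1; set Q := p ^ l => gap S_ge.
have jk : p.+2 = j + k by rewrite subnK.
have sqE : p.+2 * p.+2 - k = p.+2 * p.+1 + j by rewrite /j; lia.
have := leq_mul (leqnn j) gap; have := leq_mul S_ge (leqnn Q).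
by rewrite sqE {3}jk; lia.
Qed.
End LowerBound.

Lemma list_color_function_le (G : sgraph) m (L : list_assignment G) :
  is_massignment m L -> list_color_function G m <= num_list_colorings L.
Proof.
move=> Lm; have /leastP[_ minL] : ([set num_list_colorings L | L in @is_massignment G m] !=set0)%classic.
  by exists (num_list_colorings L), L.
by apply: minL; exists L.
Qed.

Lemma card_fset_uniq (s : seq nat) : uniq s -> #|` [fset x in s]%fset| = size s.
Proof. by move=> us; rewrite card_fseq undup_id. Qed.

Definition const_assignment (G : sgraph) (m : nat) : list_assignment G := fun=> [fset x in iota 0 m]%fset.

Lemma const_assignment_massignment (G : sgraph) m : is_massignment m (@const_assignment G m).
Proof. by move=> v; rewrite card_fset_uniq ?iota_uniq // size_iota. Qed.

Lemma num_const_assignment_K2 l m :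
  num_list_colorings (@const_assignment 'K_{2, l} m) = chromatic_poly 'K_{2, l} m.
Proof.
rewrite chromatic_poly_K2 num_list_colorings_palette.
rewrite (card_colorings_K2_const (A := palette_list (@const_assignment 'K_{2, l} m) (inl ord0)) (m := m)) //.
by rewrite card_palette_list const_assignment_massignment.
Qed.

(** The constant assignment attains the lower bound of [sum_extensions_ge]. *)
Lemma list_color_function_K2 l p : 0 < p -> l <= p ->
  list_color_function 'K_{2, l.+1} p.+2 = chromatic_poly 'K_{2, l.+1} p.+2.
Proof.
move=> p0 lp; apply/eqP; rewrite eqn_leq -{1}num_const_assignment_K2.
rewrite list_color_function_le; last exact: const_assignment_massignment.
have /leastP[[L Lm LE] _] :
    ([set num_list_colorings L | L in @is_massignment 'K_{2, l.+1} p.+2] !=set0)%classic.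
  by eexists; exists (@const_assignment 'K_{2, l.+1} p.+2) => //; exact: const_assignment_massignment.
rewrite /list_color_function -LE num_list_colorings_palette card_colorings_K2 chromatic_poly_K2.
by apply: sum_extensions_ge => // *; rewrite card_palette_list Lm.
Qed.

(** By [list_color_function_K2] some number satisfies the condition that defines
    the threshold, so the threshold itself satisfies it. *)
Lemma threshold_K2P l m : threshold 'K_{2, l.+1} <= m ->
  list_color_function 'K_{2, l.+1} m = chromatic_poly 'K_{2, l.+1} m.
Proof.
suff /leastP[[_ H] _] : ([set k | chromatic_number 'K_{2, l.+1} <= k /\
    forall m, k <= m ->
    list_color_function 'K_{2, l.+1} m = chromatic_poly 'K_{2, l.+1} m] !=set0)%classic by exact: H.
exists (chromatic_number 'K_{2, l.+1} + l.+3); split; first exact: leq_addr.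
by move=> [|[|p]] lep; [lia | lia | apply: list_color_function_K2; lia].
Qed.

(** * An assignment with few colorings *)

(** Colors 4, ..., k + 3 are common to all lists; [x] and [y] are private
    colors below 4. *)
Definition bad_list k x y : {fset nat} := [fset z in [:: x, y & iota 4 k]]%fset.

(** The parities of [i] and of [i./2] run through the four pairs of private
    colors with period 4. The vertices beyond [4 * q] repeat the list of the
    first hub: as this list always contains the color of that hub, it leaves at
    most k + 1 choices, no more than the constant assignment leaves when the
    hubs agree. *)
Definition bad_assignment l q k : list_assignment 'K_{2, l} := fun v =>
  match v with
  | inl j => if j == ord0 then bad_list k 0 1 else bad_list k 2 3
  | inr i => if i < 4 * q then bad_list k (odd i) (2 + odd i./2)
             else bad_list k 0 1
  end.

Lemma bad_list_uniq k x y : x != y -> x < 4 -> y < 4 -> uniq [:: x, y & iota 4 k].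
Proof. by move=> xy x4 y4; rewrite /= inE !mem_iota iota_uniq; lia. Qed.

Lemma card_bad_list k x y : x != y -> x < 4 -> y < 4 -> #|` bad_list k x y| = k.+2.
Proof. by move=> *; rewrite card_fset_uniq ?bad_list_uniq //= size_iota. Qed.

Lemma bad_assignment_massignment l q k : is_massignment k.+2 (@bad_assignment l q k).
Proof.
case=> [j|i] /=; case: ifP => _; rewrite card_bad_list //.
all: by case: odd; case: odd.
Qed.

Lemma big_bad_list k x y (F : nat -> nat) : x != y -> x < 4 -> y < 4 ->
  \sum_(a <- bad_list k x y) F a = F x + F y + \sum_(c <- iota 4 k) F c.
Proof.
move=> xy x4 y4; transitivity (\sum_(a <- [:: x, y & iota 4 k]) F a); last by rewrite !big_cons addnA.
apply/perm_big/uniq_perm.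
- exact: fset_uniq.
- exact: bad_list_uniq.
by move=> z; rewrite !inE.
Qed.

(** The two parities determine [i] modulo 4, and each residue occurs [q] times:
    this groups the vertices that have the same list. *)
Lemma prod_mod4 q r (g : bool -> bool -> nat) h :
  \prod_(0 <= i < 4 * q + r) (if i < 4 * q then g (odd i) (odd i./2) else h) =
  (g false false * g true false * (g false true * g true true)) ^ q * h ^ r.
Proof.
rewrite (@big_cat_nat _ _ _ (4 * q)) ?leq_addr //=; congr (_ * _); last first.
  rewrite (eq_big_nat _ _ (F2 := fun=> h)) => [|i /andP[]]; last by rewrite leqNgt => /negbTE ->.
  by rewrite prod_nat_const_nat addKn.
rewrite (eq_big_nat _ _ (F2 := fun i => g (odd i) (odd i./2))) => [|i /andP[_ ->]] //.
elim: q => [|q IH]; first by rewrite big_geq.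
have -> : 4 * q.+1 = (4 * q).+4 by lia.
rewrite !big_nat_recr // IH expnSr !mulnA.
by congr (_ * g _ _ * g _ _ * g _ _ * g _ _); lia.
Qed.

Definition residual k x y a b := #|` (bad_list k x y `\ a `\ b)%fset|.

Lemma residualE k x y a b : x != y -> x < 4 -> y < 4 ->
  residual k x y a b =
  k.+2 - ((a \in bad_list k x y) + ((b != a) && (b \in bad_list k x y))).
Proof.
move=> xy x4 y4; rewrite -(card_bad_list k xy) //.
rewrite (cardfsD1 a (bad_list k x y)) (cardfsD1 b (bad_list k x y `\ a)%fset) in_fsetD1.
by rewrite /residual addnA addKn.
Qed.

Definition extensions l q k a b :=
  \prod_(i < l) #|` (@bad_assignment l q k (inr i) `\ a `\ b)%fset|.

Lemma extensionsE q r k a b :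
  extensions (4 * q + r) q k a b =
  (residual k 0 2 a b * residual k 1 2 a b *
    (residual k 0 3 a b * residual k 1 3 a b)) ^ q * residual k 0 1 a b ^ r.
Proof.
rewrite -(prod_mod4 q r (fun s t => residual k s (2 + t) a b)) big_mkord.
by apply: eq_bigr => i _ /=; case: ifP.
Qed.

Lemma mem_bad_list k x y z :
  (z \in bad_list k x y) = [|| z == x, z == y | (4 <= z < 4 + k)].
Proof. by rewrite !inE /= mem_iota. Qed.

Section Extensions.
Variables (q r k : nat).
Local Notation ext := (extensions (4 * q + r) q k).

(** Of the four kinds of lists, one contains both colors, two contain exactly
    one, and one contains none. *)
Lemma ext_private a b : a < 2 -> 2 <= b < 4 ->
  ext a b = (k * k.+1 ^ 2 * k.+2) ^ q * k.+1 ^ r.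
Proof.
rewrite extensionsE !residualE // !mem_bad_list.
by case: a => [|[|]] //; case: b => [|[|[|[|]]]] //= _ _;
  congr (_ ^ q * _ ^ r); lia.
Qed.

Lemma ext_private_common a c : a < 2 -> 4 <= c < 4 + k ->
  ext a c = (k * k.+1) ^ (2 * q) * k ^ r.
Proof.
rewrite extensionsE !residualE // !mem_bad_list => a2 ck; rewrite ck expnM.
have [c0 c1] : (c != 0) /\ (c != 1) by lia.
case: a a2 => [|[|]] //= _; rewrite ?c0 ?c1 !orbT; congr (_ ^ q * _ ^ r); lia.
Qed.

Lemma ext_common_private c b : 2 <= b < 4 -> 4 <= c < 4 + k ->
  ext c b = (k * k.+1) ^ (2 * q) * k.+1 ^ r.
Proof.
rewrite extensionsE !residualE // !mem_bad_list => b4 ck; rewrite ck expnM.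
have [c2 c3] : (2 != c) /\ (3 != c) by lia.
case: b b4 => [|[|[|[|]]]] //= _; rewrite ?c2 ?c3 !orbT;
  congr (_ ^ q * _ ^ r); lia.
Qed.

Lemma ext_common c d : 4 <= c < 4 + k -> 4 <= d < 4 + k ->
  ext c d = (k + (c == d)) ^ (4 * q + r).
Proof.
rewrite extensionsE !residualE // !mem_bad_list => ck dk; rewrite ck dk eq_sym.
by rewrite !orbT andbT expnD expnM; congr (_ ^ q * _ ^ r); case: eqP; lia.
Qed.

Lemma sum_seq_const (s : seq nat) F v : {in s, forall x, F x = v} ->
  \sum_(x <- s) F x = size s * v.
Proof.
by move=> Fv; rewrite big_seq (eq_bigr (fun=> v)) // -big_seq big_const_seq count_predT iter_addn_0 mulnC.
Qed.

Lemma num_bad_colorings :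
  num_list_colorings (@bad_assignment (4 * q + r) q k) =
    4 * ((k * k.+1 ^ 2 * k.+2) ^ q * k.+1 ^ r)
  + 2 * k * ((k * k.+1) ^ (2 * q) * (k ^ r + k.+1 ^ r))
  + k * (k.+1 ^ (4 * q + r) + k.-1 * k ^ (4 * q + r)).
Proof.
have iotaP c : c \in iota 4 k -> 4 <= c < 4 + k by rewrite mem_iota.
have -> : num_list_colorings (@bad_assignment (4 * q + r) q k) =
    \sum_(a <- bad_list k 0 1) \sum_(b <- bad_list k 2 3) ext a b.
  exact: num_list_colorings_K2.
rewrite big_bad_list //.
have privE a : a < 2 -> \sum_(b <- bad_list k 2 3) ext a b =
    2 * ((k * k.+1 ^ 2 * k.+2) ^ q * k.+1 ^ r) + k * ((k * k.+1) ^ (2 * q) * k ^ r).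
  move=> a2; rewrite big_bad_list // !ext_private //.
  rewrite (sum_seq_const (v := (k * k.+1) ^ (2 * q) * k ^ r)) ?size_iota; first by lia.
  by move=> c /iotaP ck; rewrite ext_private_common.
rewrite !privE //.
rewrite (sum_seq_const (v := 2 * ((k * k.+1) ^ (2 * q) * k.+1 ^ r) + (k.+1 ^ (4 * q + r) + k.-1 * k ^ (4 * q + r)))).
  by rewrite size_iota; lia.
move=> c cI; have ck := iotaP c cI; rewrite big_bad_list // !ext_common_private //.
rewrite (bigD1_seq c) ?iota_uniq //= ext_common // eqxx addn1.
rewrite -big_filter (sum_seq_const (v := k ^ (4 * q + r))); last first.
  move=> d; rewrite mem_filter => /andP[dc /iotaP dk].
  by rewrite ext_common // eq_sym (negPf dc) addn0.
have -> : size [seq d <- iota 4 k | d != c] = k.-1.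
  by rewrite size_filter; have := count_predC (pred1 c) (iota 4 k);
    rewrite count_uniq_mem ?iota_uniq // cI size_iota => /(congr1 predn) <-.
lia.
Qed.
End Extensions.

(** The factor 2 on the right is the number of pairs of equal hub colors that
    the assignment lacks: k instead of k + 2. *)
Lemma num_bad_colorings_lt q r k :
  4 * (k * k.+1 ^ 2 * k.+2) ^ q + 4 * k * (k * k.+1) ^ (2 * q) < 2 * k.+1 ^ (4 * q) ->
  num_list_colorings (@bad_assignment (4 * q + r) q k) <
  chromatic_poly 'K_{2, 4 * q + r} k.+2.
Proof.
rewrite num_bad_colorings chromatic_poly_K2 /= !(expnD _ (4 * q)).
set X := (_ * _) ^ q; set Y := (_ * _) ^ (2 * q); set n := k.+1; set N := n ^ (4 * q).
move=> H.
have kr : k ^ r <= n ^ r by case: r => // r; rewrite leq_exp2r.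
have nr : 0 < n ^ r by rewrite expn_gt0.
have H1 := leq_mul H (leqnn (n ^ r)).
have H2 := leq_mul (leqnn (2 * k * Y)) kr.
have kk : k * k.-1 <= k.+2 * n by rewrite leq_mul // /n; lia.
have H3 := leq_mul kk (leqnn (k ^ (4 * q) * k ^ r)).
move: H1 H2 H3; set Z := k.+2 * n * _.
move: (n ^ r) nr (k ^ r) {H kr kk} => nr nr0 kr H1 H2 H3.
by rewrite -/N; move: X Y N Z (k.-1) H1 H2 H3 => *; lia.
Qed.

(** * The list chromatic number *)

Lemma K2_3choosable l (L : list_assignment 'K_{2, l}) :
  is_massignment 3 L -> 0 < num_list_colorings L.
Proof.
move=> L3.
have ex v : exists a, a \in L v by apply/fset0Pn; rewrite -cardfs_gt0 L3.
have [a aL] := ex (inl ord0); have [b bL] := ex (inl ord_max).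
rewrite num_list_colorings_K2 (big_fsetD1 a) //= (big_fsetD1 b) //= -addnA ltn_addr //.
apply: prodn_gt0 => i.
have := cardfsD1 a (L (inr i)); have := cardfsD1 b (L (inr i) `\ a)%fset.
by rewrite L3 => ->; case: (a \in _); case: (b \in _); case: #|` _|.
Qed.

(** With two colors per list, and hence no common color, [bad_assignment] has no
    coloring: whatever the colors of the hubs, some list consists of just these
    two. *)
Lemma list_chromatic_number_K2 l : 4 <= l -> list_chromatic_number 'K_{2, l} = 3.
Proof.
move=> l4; pose P := [set k | forall L : list_assignment 'K_{2, l},
  is_massignment k L -> exists f, f \in list_colorings L]%classic.
have P3 : P 3 by move=> L /K2_3choosable; rewrite card_gt0 => /set0Pn.
have /leastP[Pl lP] : (P !=set0)%classic by exists 3.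
rewrite -[list_chromatic_number _]/(least P); apply/eqP; rewrite eqn_leq lP //= leqNgt.
have Pgt0 (L : list_assignment 'K_{2, l}) : is_massignment (least P) L -> 0 < num_list_colorings L.
  by move=> Lk; rewrite card_gt0; apply/set0Pn; exact: Pl.
apply/negP => lt3; have [] : least P = 2 \/ least P < 2 by lia.
  move=> P2; have := Pgt0 (@bad_assignment l (l %/ 4) 0).
  rewrite P2 => /(_ (@bad_assignment_massignment _ _ _)).
  have := num_bad_colorings (l %/ 4) (l %% 4) 0.
  have -> : 4 * (l %/ 4) + l %% 4 = l by rewrite mulnC -divn_eq.
  by move=> ->; rewrite !mul0n exp0n ?divn_gt0.
move=> P1; have := Pgt0 _ (@const_assignment_massignment 'K_{2, l} (least P)).
rewrite num_const_assignment_K2 chromatic_poly_K2.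
case: (least P) P1 => [|[|]] // _; rewrite !mul0n.
by rewrite exp0n; lia.
Qed.

(** * Estimates and the threshold *)

Local Open Scope ring_scope.

Section Analysis.
Variable R : realType.
Local Notation lam := (ln (16 / 7 : R)).

Lemma ln_16_7_gt0 : 0 < lam.
Proof. by apply: ln_gt0; lra. Qed.

(** e >= (1 + 1/4)^4 = 625/256 > 16/7. *)
Lemma ln_16_7_lt1 : lam < 1.
Proof.
rewrite -ltr_expR lnK ?posrE; last by lra.
have -> : expR 1 = expR 4^-1 ^+ 4 :> R by rewrite -expRM_natl divff ?pnatr_eq0.
have : 1 + 4^-1 <= expR 4^-1 :> R by exact: expR_ge1Dx.
move: (expR _) => x x54; have x2 : 25 / 16 <= x ^+ 2 by nra.
by rewrite (exprM x 2 2); nra.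
Qed.

(** Since 1 - x <= exp(-x) and 7/16 = exp(- ln(16/7)). *)
Lemma pow1B_le (x : R) (n j : nat) : 0 <= x <= 1 -> lam * j%:R <= n%:R * x ->
  (1 - x) ^+ n <= (7 / 16) ^+ j.
Proof.
move=> /andP[x0 x1] H.
have e : 7 / 16 = expR (- lam) :> R.
  by rewrite expRN lnK ?posrE; lra.
apply: (@le_trans _ _ (expR (- x) ^+ n)).
  by rewrite lerXn2r ?nnegrE ?expR_ge0 ?subr_ge0 // expR_ge1Dx.
by rewrite e -!expRM_natl ler_expR; lra.
Qed.

(** This leaves room for 4 * (7/16) = 7/4 within the 2 units available in
    [num_bad_colorings_lt]. *)
Lemma one_private_term_small k : (0 < k)%N -> 16 * k%:R * (7 / 16) ^+ (2 * k.+1) < 1 :> R.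
Proof.
rewrite exprM; elim: k => // -[|k] IH _; first by lra.
have {}IH := IH isT.
rewrite exprS; move: IH; set y := _ ^+ k.+2.
have y0 : 0 <= y by apply/exprn_ge0/exprn_ge0; lra.
rewrite -(addn1 k.+1) natrD.
have : 1 <= k.+1%:R :> R by rewrite ler1n.
move: (k.+1%:R) => z; nra.
Qed.

(** With n = k + 1 the two products are n^4 (1 - 1/n^2) and n^2 (1 - 1/n), so
    that after division by n^(4 q) both powers are handled by [pow1B_le]. *)
Lemma bad_condition q k : (0 < k)%N -> lam * k.+1%:R ^+ 2 <= q%:R ->
  (4 * (k * k.+1 ^ 2 * k.+2) ^ q + 4 * k * (k * k.+1) ^ (2 * q) < 2 * k.+1 ^ (4 * q))%N.
Proof.
move=> k0 H; rewrite -(ltr_nat R) !(natrD, natrM, natrX).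
set n : R := k.+1%:R.
have n0 : 1 <= n by rewrite ler1n.
have nk : n = k%:R + 1 by rewrite /n -natr1.
have kE : k%:R = n * (1 - n^-1) by rewrite mulrBr mulr1 divff ?lt0r_neq0; lra.
have k2E : k.+2%:R = n + 1 by rewrite /n -natr1.
have n1 : 0 <= n^-1 <= 1 by rewrite invr_ge0 invf_le1; lra.
have -> : k%:R * n ^+ 2 * k.+2%:R = n ^+ 4 * (1 - n ^- 2).
  by rewrite kE k2E; field; lra.
have -> : k%:R * n = n ^+ 2 * (1 - n^-1) by rewrite kE; ring.
have XM i x j : (n ^+ i * x) ^+ j = n ^+ (i * j) * x ^+ j by rewrite exprM -exprMn.
rewrite !XM mulnA.
have A : (1 - n ^- 2) ^+ q <= (7 / 16) ^+ 1.
  apply: pow1B_le; last by rewrite mulr1 ler_pdivlMr //; nra.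
  by case/andP: n1 => *; rewrite -exprVn exprn_ge0 // exprn_ile1.
have B : (1 - n^-1) ^+ (2 * q) <= (7 / 16) ^+ (2 * k.+1).
  apply: pow1B_le => //.
  rewrite ler_pdivlMr ?natrM -/n; nra.
have C := one_private_term_small k0.
have N0 : 0 < n ^+ (4 * q) by rewrite exprn_gt0 //; lra.
rewrite [2 * _]mulrC mulrCA [4 * k%:R * _]mulrCA -mulrDr ltr_pM2l //.
have : 0 <= k%:R :> R by [].
nra.
Qed.

(** The equality of the two color functions holds at every m from the threshold
    on, so if the threshold were at most s + 1 it would hold at
    m = max (threshold, 3) <= s + 1, where [bad_assignment] refutes it. *)
Lemma threshold_K2_gt l : (16 <= l)%N ->
  Num.sqrt ((l %/ 4)%:R / lam) + 1 < (threshold 'K_{2, l})%:R :> R.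
Proof.
move=> l16; rewrite ltNge; apply/negP; set s := Num.sqrt _ => tau_le.
have q4 : (4 <= l %/ 4)%N by lia.
have [l0 l1] := (ln_16_7_gt0, ln_16_7_lt1).
have sq0 : 0 <= (l %/ 4)%:R / lam by rewrite divr_ge0 // ltW.
have s2 : s ^+ 2 = (l %/ 4)%:R / lam by rewrite sqr_sqrtr.
have s_ge2 : 2 <= s.
  rewrite -(@ler_pXn2r _ 2) ?nnegrE ?sqrtr_ge0 // s2 ler_pdivlMr //.
  have : 4 <= (l %/ 4)%:R :> R by rewrite ler_nat.
  nra.
pose t := maxn (threshold 'K_{2, l}) 3.
have t_le : t%:R <= s + 1.
  by rewrite /t; case: leqP => _ //; lra.
have [k tE] : exists k, t = k.+3 by exists (t - 3)%N; rewrite /t; lia.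
have /bad_condition : lam * k.+2%:R ^+ 2 <= (l %/ 4)%:R.
  rewrite mulrC -ler_pdivlMr // -s2 ler_pXn2r ?nnegrE ?sqrtr_ge0 //.
  by move: t_le; rewrite tE -natr1; lra.
move=> /(_ isT)/(@num_bad_colorings_lt _ (l %% 4)).
have -> : (4 * (l %/ 4) + l %% 4 = l)%N by rewrite mulnC -divn_eq.
apply/negP; rewrite -leqNgt.
case: l l16 {q4 sq0 s2 s tau_le s_ge2 t_le} @t tE => // l l16 t tE.
rewrite -threshold_K2P -?tE ?leq_maxl //.
rewrite list_color_function_le // tE.
exact: bad_assignment_massignment.
Qed.

End Analysis.

Theorem theorem4 (R : realType) :
  (forall l : nat, (16 <= l)%N ->
     let q := (l %/ 4)%N in
     Num.floor (Num.sqrt (q%:R / ln (16 / 7 : R)) + 1)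
       < (threshold 'K_{2, l})%:Z)
  /\
  (exists C : R, 0 < C /\
     forall l : nat, (16 <= l)%N ->
       (threshold 'K_{2, l})%:R - (list_chromatic_number 'K_{2, l})%:R
         = (threshold 'K_{2, l})%:R - 3 :> R
       /\ C * Num.sqrt l%:R <= (threshold 'K_{2, l})%:R - 3).
Proof.
split; first by move=> l l16 /=; rewrite floor_lt_int; exact: threshold_K2_gt.
have [l0 l1] := (@ln_16_7_gt0 R, @ln_16_7_lt1 R).
pose D : R := Num.sqrt (ln (16 / 7))^-1 - 1.
have D0 : 0 < D.
  by rewrite subr_gt0 -[X in X < _]sqrtr1 ltr_sqrt ?invr_gt0 // invf_gt1.
exists (D / 3); split=> [|l l16]; first by lra.
split; first by rewrite list_chromatic_number_K2 //; lia.
have := threshold_K2_gt R l16.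
rewrite sqrtrM // -[Num.sqrt _^-1](subrK 1) -/D.
set sq := Num.sqrt (l %/ 4)%:R.
have sq2 : 2 <= sq.
  rewrite -(@ler_pXn2r _ 2) ?nnegrE ?sqrtr_ge0 // sqr_sqrtr // -natrX ler_nat; lia.
(* l <= 4 q + 3 <= 9 q *)
have : Num.sqrt l%:R <= 3 * sq.
  rewrite -(@ler_pXn2r _ 2) ?nnegrE ?mulr_ge0 ?sqrtr_ge0 // exprMn !sqr_sqrtr //.
  rewrite -natrX -natrM ler_nat; lia.
move=> /(ler_wpM2l (ltW D0)); lra.
Qed.
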